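(* Let $T$ be a closed subnormal (possibly unbounded) operator in a complex Hilbert space $H$ such that $T^n$ is normal for some integer $n\geq 2$. Then $T$ is normal.
   Context: Operators are linear and not necessarily bounded. Powers are defined on natural domains, with $D(ST)=\{x\in D(T):Tx\in D(S)\}$. A densely defined operator $S$ is normal if it is closed and $SS^*=S^*S$ (equality including domains). A densely defined operator $S$ with domain $D(S)\subset H$ is subnormal if there are a Hilbert space $K$ containing $H$ (as a closed subspace with the same inner product) and a normal operator $N$ in $K$, with domain $D(N)\subset K$, such that $D(S)\subset D(N)$ and $Sx=Nx$ for all $x\in D(S)$. *)

(* Defs.v *)
From HB Require Import structures.
From mathcomp Require Import all_boot all_order all_algebra sesquilinear complex.
From mathcomp Require Import all_classical all_reals all_analysis.
Import Order.TTheory GRing.Theory Num.Theory.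
Import numFieldNormedType.Exports.

Set Implicit Arguments.
Unset Strict Implicit.
Unset Printing Implicit Defensive.

Local Open Scope classical_set_scope.
Local Open Scope ring_scope.

(* The norm of a normed module over R[i] takes its values in R[i].  The inner
   product is linear in its first argument and conjugate-linear in its
   second. *)
Record hilbertType (R : realType) := Hilbert {
  hilbert_sort :> completeNormedModType R[i];
  inner : {dot hilbert_sort for @Num.conj R[i]};
  inner_normE : forall x : hilbert_sort, `|x| ^+ 2 = inner x x
}.

Section Operators.
Variables (R : realType).
Implicit Types H K : hilbertType R.

(* A partially defined map: only the values of [app] on [dom] are meaningful,
   so that operators are compared with [op_eq] and never with [=]. *)
Record partial_op H := PartialOp { dom : set H; app :> H -> H }.

Definition linear_op H (T : partial_op H) : Prop :=
  dom T 0 /\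
  forall (a : R[i]) (x y : H), dom T x -> dom T y ->
    dom T (a *: x + y) /\ T (a *: x + y) = a *: T x + T y.

Definition op_eq H (S T : partial_op H) : Prop :=
  dom S = dom T /\ forall x, dom S x -> S x = T x.

Definition op_id H : partial_op H := PartialOp setT id.

Definition op_comp H (S T : partial_op H) : partial_op H :=
  PartialOp [set x | dom T x /\ dom S (T x)] (S \o T).

Definition op_exp H (T : partial_op H) (n : nat) : partial_op H :=
  iter n (op_comp T) (op_id H).

Definition op_graph H (T : partial_op H) : set (H * H) :=
  [set p | dom T p.1 /\ p.2 = T p.1].

Definition closed_op H (T : partial_op H) : Prop := closed (op_graph T).

(* [is_adjoint_value T y z] says that z is a candidate for the value at y of
   the adjoint of T; it is unique when [dom T] is dense. *)
Definition is_adjoint_value H (T : partial_op H) (y z : H) : Prop :=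
  forall x, dom T x -> inner H (T x) y = inner H x z.

(* To be used for densely defined T only. *)
Definition adjoint H (T : partial_op H) : partial_op H :=
  PartialOp [set y | exists z, is_adjoint_value T y z]
            (fun y => xget 0 [set z | is_adjoint_value T y z]).

Definition normal_op H (T : partial_op H) : Prop :=
  [/\ linear_op T, dense (dom T), closed_op T &
      op_eq (op_comp T (adjoint T)) (op_comp (adjoint T) T)].

(* The inclusion of H in K is an isometric linear embedding j with closed
   range. *)
Definition subnormal_op H (S : partial_op H) : Prop :=
  [/\ linear_op S, dense (dom S) &
      exists (K : hilbertType R) (j : {linear H -> K}) (N : partial_op K),
        [/\ forall x y : H, inner K (j x) (j y) = inner H x y,
            closed (range j),
            normal_op N &
            forall x, dom S x -> dom N (j x) /\ N (j x) = j (S x)]].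

End Operators.

(* Main.v *)
(* Let N be a normal extension of T in K, S = T^n and A = N*N. For x in D(S) the
   projection of N*^n x to H is S* x, and both vectors have norm |Sx|, so N*^n
   extends S*. Hence A^n extends S*S and the resolvent C = (1 + A^n)^-1 leaves H
   invariant. The bounded positive operator X = A C^2 is such that X^n is a
   polynomial in C, so X^n commutes with the projection P onto H; since positive
   n-th roots commute with whatever commutes with the power, so does X, and then
   so does (1 + A)^-1. As H is also invariant under the bounded operator
   N (1 + A)^-1 and reduces its n-th power, it reduces this operator too. Thus
   the part of N in H is normal, and it coincides with T because the range of
   (1 + S*S)^-1 is contained in D(T).

   Instead of the spectral theorem, the root statement uses the components
   Y_w = sum_j w^j X^j P X^(n-1-j), w^n = 1, which satisfy Y_w X = w X Y_w; this
   forces X^n Y_w = 0 when w <> 1, by comparing the growth of powers of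
   1 - t X^m and 1 - t w^m X^m. *)

From HB Require Import structures.
From mathcomp Require Import all_boot all_order all_algebra sesquilinear complex.
From mathcomp Require Import all_classical all_reals all_analysis.
From mathcomp Require Import ring lra zify.
From mathcomp Require Import cyclic separable cyclotomic.
Require Import Defs.
Import Order.TTheory GRing.Theory Num.Theory.
Import numFieldNormedType.Exports.

Set Implicit Arguments.
Unset Strict Implicit.
Unset Printing Implicit Defensive.

Local Open Scope classical_set_scope.
Local Open Scope ring_scope.
Local Open Scope complex_scope.

(** * Projection onto closed linear relations *)

Section InnerProduct.
Variables (R : realType) (K : hilbertType R).
Implicit Types (x y z : K) (c : R[i]).

(** The squared norm, kept real so that order arguments take place in [R] although the norm itself
    has values in [R[i]]. *)
Definition n2 x : R := complex.Re (inner K x x).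
Definition ip x y : R[i] := inner K x y.

Lemma ipDl x y z : ip (x + y) z = ip x z + ip y z.
Proof. by rewrite /ip linearDl. Qed.
Lemma ipNl x z : ip (- x) z = - ip x z.
Proof. by rewrite /ip linearNl. Qed.
Lemma ipZl c x z : ip (c *: x) z = c * ip x z.
Proof. by rewrite /ip linearZl_LR. Qed.
Lemma ipC x y : ip x y = (ip y x)^*%C.
Proof. by rewrite /ip hermC expr0 mul1r. Qed.
Lemma ipDr x y z : ip z (x + y) = ip z x + ip z y.
Proof. by rewrite /ip linearDr. Qed.
Lemma ipNr x z : ip z (- x) = - ip z x.
Proof. by rewrite /ip linearNr. Qed.
Lemma ipZr c x z : ip z (c *: x) = c^*%C * ip z x.
Proof. by rewrite ipC ipZl rmorphM /= [in RHS]ipC. Qed.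
Lemma ip0l z : ip 0 z = 0.
Proof. by rewrite /ip linear0l. Qed.
Lemma ip0r z : ip z 0 = 0.
Proof. by rewrite /ip linear0r. Qed.

Lemma ipxx x : ip x x = (n2 x)%:C.
Proof.
have := ipC x x; rewrite /n2 /ip; case: (inner K x x) => a b [] /= h.
by congr Complex; lra.
Qed.

Lemma norm2E x : `|x| ^+ 2 = (n2 x)%:C.
Proof. by rewrite inner_normE -ipxx. Qed.

Lemma n2_ge0 x : 0 <= n2 x.
Proof. by rewrite -lecR -norm2E exprn_ge0. Qed.

Lemma n2_eq0 x : n2 x = 0 -> x = 0.
Proof.
by move=> h; apply/eqP; rewrite -normr_eq0 -sqrf_eq0 norm2E h.
Qed.
End InnerProduct.

(** * Real part of the inner product, convergence and completeness *)

Section Limits.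
Variables (R : realType) (K : hilbertType R).
Implicit Types (x y z : K) (c : R[i]).

Definition rp x y : R := complex.Re (ip x y).

Lemma rpDl x y z : rp (x + y) z = rp x z + rp y z.
Proof. by rewrite /rp ipDl raddfD. Qed.
Lemma rpNl x z : rp (- x) z = - rp x z.
Proof. by rewrite /rp ipNl raddfN. Qed.
Lemma rpC x y : rp x y = rp y x.
Proof. by rewrite /rp ipC; case: (ip y x). Qed.
Lemma rpDr x y z : rp z (x + y) = rp z x + rp z y.
Proof. by rewrite /rp ipDr raddfD. Qed.
Lemma rpNr x z : rp z (- x) = - rp z x.
Proof. by rewrite /rp ipNr raddfN. Qed.
Lemma rpZl (t : R) x z : rp (t%:C *: x) z = t * rp x z.
Proof. by rewrite /rp ipZl; case: (ip x z) => a b /=; rewrite mul0r subr0. Qed.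
Lemma rpZr (t : R) x z : rp z (t%:C *: x) = t * rp z x.
Proof. by rewrite rpC rpZl rpC. Qed.
Lemma rpxx x : rp x x = n2 x. Proof. by []. Qed.

Lemma n2D x y : n2 (x + y) = n2 x + 2 * rp x y + n2 y.
Proof. by rewrite -!rpxx !(rpDl, rpDr) (rpC y x); ring. Qed.
Lemma n2N x : n2 (- x) = n2 x.
Proof. by rewrite -!rpxx rpNl rpNr opprK. Qed.
Lemma n2B x y : n2 (x - y) = n2 x - 2 * rp x y + n2 y.
Proof. by rewrite n2D n2N rpNr; ring. Qed.
Lemma n2ZR (t : R) x : n2 (t%:C *: x) = t ^+ 2 * n2 x.
Proof. by rewrite -!rpxx rpZl rpZr; ring. Qed.
Lemma n2Z c x : n2 (c *: x) = (complex.Re c ^+ 2 + complex.Im c ^+ 2) * n2 x.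
Proof.
apply: complexI; rewrite -ipxx ipZl ipZr ipxx mulrA rmorphM /=.
congr (_ * _); case: c => a b; apply/eqP; rewrite eq_complex /=.
by apply/andP; split; apply/eqP; ring.
Qed.
Lemma n2_0 : n2 (0 : K) = 0.
Proof. by rewrite -rpxx /rp ip0l. Qed.

Lemma n2D_le x y : n2 (x + y) <= 2 * n2 x + 2 * n2 y.
Proof. by have := n2_ge0 (x - y); rewrite n2B n2D; lra. Qed.

Definition tends (u : nat -> K) x :=
  forall e : R, 0 < e -> exists N, forall k, (N <= k)%N -> n2 (x - u k) < e.

Lemma norm_lt_n2 x (e : R) : 0 < e -> (n2 x < e ^+ 2) = (`|x| < e%:C).
Proof.
move=> e0; rewrite -ltcR -norm2E rmorphXn /= ltr_pXn2r// nnegrE ?normr_ge0// ler0c ltW//.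
Qed.

Lemma n2_complete (u : nat -> K) :
  (forall e : R, 0 < e -> exists N, forall k l, (N <= k)%N -> (N <= l)%N ->
     n2 (u k - u l) < e) ->
  exists x, tends u x.
Proof.
move=> cu.
have : cauchy (u @ \oo).
  apply/cauchyP => _/posnumP[e].
  have e0 : (0 : R[i]) < e%:num by [].
  have eE : e%:num = (complex.Re e%:num)%:C.
    by rewrite RRe_real// gtr0_real.
  have [e1 [e1_0 ->]] : exists e1 : R, 0 < e1 /\ e%:num = e1%:C.
    by exists (complex.Re e%:num); split=> //; rewrite -ltcR -eE.
  have [N HN] := cu (e1 ^+ 2) (exprn_gt0 _ e1_0).
  exists (u N); exists N => // k /= Nk.
  by rewrite -ball_normE /= -norm_lt_n2//; exact: HN.
move=> /cauchy_cvgP /cvg_ex [x xP]; exists x => e e0.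
have se0 : 0 < (Num.sqrt e) by rewrite sqrtr_gt0.
have /cvgrPdist_lt /(_ (Num.sqrt e)%:C) := xP.
rewrite ltcR => /(_ se0) [N _ HN]; exists N => k Nk.
by rewrite -(@sqr_sqrtr _ e) ?ltW// norm_lt_n2//; exact: HN.
Qed.
End Limits.

(** * Orthogonal projection onto a closed linear relation *)

Section Projection.
Variables (R : realType) (K1 K2 : hilbertType R).
Implicit Type G : K1 -> K2 -> Prop.

Definition linear_rel G := G 0 0 /\ forall (c : R[i]) x y x' y',
  G x y -> G x' y' -> G (c *: x + x') (c *: y + y').

Definition closed_rel G := forall u v x y,
  (forall k : nat, G (u k) (v k)) -> tends u x -> tends v y -> G x y.

(** [G] is a closed subspace of the direct sum of [K1] and [K2], which is never built as a Hilbert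
    space. A minimizing sequence is Cauchy by the parallelogram law, and the first variation at its
    limit vanishes. *)
Theorem projection G (y1 : K1) (y2 : K2) : linear_rel G -> closed_rel G ->
  exists p1 p2, G p1 p2 /\
    forall w1 w2, G w1 w2 -> ip (y1 - p1) w1 + ip (y2 - p2) w2 = 0.
Proof.
move=> [G00 Glin] Gcl.
have GZ c x y : G x y -> G (c *: x) (c *: y).
  by move=> Gxy; have := Glin c _ _ _ _ Gxy G00; rewrite !addr0.
have GD x y x' y' : G x y -> G x' y' -> G (x + x') (y + y').
  by move=> Gxy Gxy'; have := Glin 1 _ _ _ _ Gxy Gxy'; rewrite !scale1r.
pose D p1 p2 := n2 (y1 - p1) + n2 (y2 - p2).
pose A := [set r : R | exists p1 p2, G p1 p2 /\ r = D p1 p2].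
have A0 : A !=set0 by exists (D 0 0), 0, 0.
have Alb : has_lbound A.
  by exists 0 => _ [p1 [p2 [_ ->]]]; rewrite addr_ge0 ?n2_ge0.
pose d := inf A.
have dle p1 p2 : G p1 p2 -> d <= D p1 p2.
  by move=> Gp; apply: ge_inf => //; exists p1, p2.
have seqE (k : nat) : exists p : K1 * K2, G p.1 p.2 /\ D p.1 p.2 < d + k.+1%:R^-1.
  have := @inf_adherent _ A k.+1%:R^-1.
  case=> [| |_ [p1 [p2 [Gp ->]]] lt]; first by rewrite invr_gt0.
    by split.
  by exists (p1, p2).
have [p Hp] := choice seqE.
have Dlt k : D (p k).1 (p k).2 < d + k.+1%:R^-1 by case: (Hp k).
have Gp k : G (p k).1 (p k).2 by case: (Hp k).
(* The midpoint of [p k] and [p l] lies in [G], so its squared distance is at least [d]; the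
   parallelogram law does the rest. *)
have par k l : n2 ((p k).1 - (p l).1) + n2 ((p k).2 - (p l).2) <=
    2 * k.+1%:R^-1 + 2 * l.+1%:R^-1.
  have := dle _ _ (GZ 2^-1%:C _ _ (GD _ _ _ _ (Gp k) (Gp l))).
  have := Dlt k; have := Dlt l; rewrite /D.
  have E (K : hilbertType R) (y a b : K) : n2 (a - b) =
      2 * n2 (y - a) + 2 * n2 (y - b) - 4 * n2 (y - 2^-1%:C *: (a + b)).
    by rewrite !n2B n2ZR rpZr n2D !rpDr; field.
  rewrite (E _ y1 (p k).1) (E _ y2 (p k).2) => h1 h2 h3.
  clear -h1 h2 h3; move: h1 h2 h3; move: (k.+1%:R^-1) (l.+1%:R^-1); move=> *; lra.
have small (e : R) : 0 < e -> exists N, forall k, (N <= k)%N -> k.+1%:R^-1 < e.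
  move=> e0; exists (Num.truncn e^-1) => k Nk.
  rewrite invf_plt ?posrE// (lt_le_trans (truncnS_gt _))// ler_nat ltnS.
  by [].
have cauchy e : 0 < e -> exists N, forall k l, (N <= k)%N -> (N <= l)%N ->
     n2 ((p k).1 - (p l).1) + n2 ((p k).2 - (p l).2) < e.
  move=> e0; have [N HN] := small (e / 4) (divr_gt0 e0 (ltr0Sn _ _)).
  exists N => k l Nk Nl; apply: le_lt_trans (par k l) _.
  by have := HN k Nk; have := HN l Nl; move: (k.+1%:R^-1) (l.+1%:R^-1) => *; lra.
have [p1 lim1] : exists x, tends (fun k => (p k).1) x.
  apply: n2_complete => e /cauchy[N HN]; exists N => k l Nk Nl.
  by apply: le_lt_trans (HN k l Nk Nl); rewrite lerDl n2_ge0.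
have [p2 lim2] : exists x, tends (fun k => (p k).2) x.
  apply: n2_complete => e /cauchy[N HN]; exists N => k l Nk Nl.
  by apply: le_lt_trans (HN k l Nk Nl); rewrite lerDr n2_ge0.
exists p1, p2; split; first exact: Gcl lim1 lim2.
pose Rp w1 w2 := rp (y1 - p1) w1 + rp (y2 - p2) w2.
(* First variation along [t w]. The factor 2 in front of [t ^+ 2] pays for replacing [p k] by its
   limit. *)
have ub w1 w2 (t : R) : G w1 w2 -> 2 * t * Rp w1 w2 <= 2 * t ^+ 2 * (n2 w1 + n2 w2).
  move=> Gw; apply/ler_addgt0Pr => e e0.
  have e3 : 0 < e / 3 by rewrite divr_gt0.
  have [N0 H0] := small _ e3.
  have [N1 H1] := lim1 _ e3; have [N2 H2] := lim2 _ e3.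
  pose k := maxn N0 (maxn N1 N2).
  have {}H0 : k.+1%:R^-1 < e / 3 by apply: H0; rewrite /k; lia.
  have {}H1 : n2 (p1 - (p k).1) < e / 3 by apply: H1; rewrite /k; lia.
  have {}H2 : n2 (p2 - (p k).2) < e / 3 by apply: H2; rewrite /k; lia.
  have := dle _ _ (Glin t%:C _ _ _ _ Gw (Gp k)); have := Dlt k; rewrite /D /Rp.
  have E (K : hilbertType R) (y q r w : K) : n2 (y - (t%:C *: w + r)) >= 0 ->
     2 * t * rp (y - q) w <= n2 (y - r) - n2 (y - (t%:C *: w + r)) +
        2 * t ^+ 2 * n2 w + n2 (q - r).
    move=> _; have := n2_ge0 (q - r + t%:C *: w).
    have -> : y - (t%:C *: w + r) = (y - r) - t%:C *: w by rewrite opprD addrA addrAC.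
    rewrite [n2 (y - r - _)]n2B (n2D (q - r)) n2ZR !rpZr.
    rewrite !(rpDl, rpNl); lra.
  have := E _ y1 p1 (p k).1 w1 (n2_ge0 _); have := E _ y2 p2 (p k).2 w2 (n2_ge0 _).
  by move: H0; move: (k.+1%:R^-1) => *; lra.
have Rle w1 w2 : G w1 w2 -> Rp w1 w2 <= 0.
  move=> Gw; rewrite leNgt; apply/negP => h.
  (* With [t = Rp / (2 s)] the linear term is [4 s t^2], which beats the bound [2 t^2 (s - 1)]; the
     1 in [s] keeps it positive. *)
  pose s := n2 w1 + n2 w2 + 1.
  have s0 : 0 < s by rewrite /s ltr_wpDl// addr_ge0 ?n2_ge0.
  have := ub w1 w2 (Rp w1 w2 / (2 * s)) Gw; set t := Rp w1 w2 / _.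
  have tE : Rp w1 w2 = 2 * s * t by rewrite /t; field; lra.
  have t0 : 0 < t by rewrite /t divr_gt0// mulr_gt0.
  have -> : n2 w1 + n2 w2 = s - 1 by rewrite /s; ring.
  rewrite tE => H; have : 2 * t ^+ 2 * s <= 0.
    have : 0 < t ^+ 2 * s by rewrite mulr_gt0 ?exprn_gt0.
    have : 0 < t ^+ 2 by rewrite exprn_gt0.
    by lra.
  by apply/negP; rewrite -ltNge mulr_gt0// mulr_gt0// exprn_gt0.
have R0 w1 w2 : G w1 w2 -> Rp w1 w2 = 0.
  move=> Gw; apply: le_anti; rewrite Rle//=.
  by have := Rle _ _ (GZ (-1) _ _ Gw); rewrite !scaleN1r /Rp !rpNr; lra.
move=> w1 w2 Gw.
(* The direction [i w] supplies the imaginary part. *)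
have := R0 _ _ Gw; have := R0 _ _ (GZ 'i%C _ _ Gw).
rewrite /Rp /rp !ipZr.
case: (ip _ w1) => a b; case: (ip _ w2) => a' b' /= h1 h2.
by congr Complex => /=; lra.
Qed.
End Projection.

(** * The *-ring of bounded operators *)

Section Operators.
Variables (R : realType) (K : hilbertType R).
Implicit Types (x y z : K).

Lemma ip_eq0 x : (forall y, ip x y = 0) -> x = 0.
Proof. by move=> /(_ x); rewrite ipxx => -[/n2_eq0]. Qed.

Lemma ip_inj x y : (forall z, ip x z = ip y z) -> x = y.
Proof.
move=> h; apply/eqP; rewrite -subr_eq0; apply/eqP/ip_eq0 => z.
by rewrite ipDl ipNl h subrr.
Qed.

Lemma ip_injr x y : (forall z, ip z x = ip z y) -> x = y.
Proof. by move=> h; apply: ip_inj => z; rewrite ipC h -ipC. Qed.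

Definition bounded_fun (f : K -> K) := exists c : R, forall x, n2 (f x) <= c * n2 x.

Lemma bounded_funP f : bounded_fun f ->
  exists2 c : R, 0 < c & forall x, n2 (f x) <= c * n2 x.
Proof.
move=> [c cP]; exists (`|c| + 1) => [|x]; first by rewrite ltr_wpDl.
apply: le_trans (cP x) _; rewrite ler_wpM2r ?n2_ge0//.
by rewrite (le_trans (ler_norm c))// lerDl.
Qed.

(** The adjoint is stored as data: additivity and homogeneity then follow from [opP], and [star]
    only swaps fields. Nondegeneracy of the inner product makes the stored adjoint unique, whence
    [op_ext]. *)
Record op := Op {
  opf :> K -> K;
  opa : K -> K;
  opP : forall x y, ip (opf x) y = ip x (opa y);
  op_bounded : bounded_fun opf;
  opa_bounded : bounded_fun opa }.

Lemma op_ext (f g : op) : (forall x, f x = g x) -> f = g.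
Proof.
move=> h; have hf : opf f = opf g by apply/funext.
have ha : opa f = opa g.
  by apply/funext => y; apply: ip_injr => z; rewrite -!opP h.
case: f g hf ha {h} => [f f' p q r] [g g' p' q' r'] /= hf hg.
by subst; congr Op; exact: Prop_irrelevance.
Qed.

Lemma opPr (f : op) x y : ip x (f y) = ip (opa f x) y.
Proof. by rewrite ipC opP -ipC. Qed.

Lemma opD (f : op) x y : f (x + y) = f x + f y.
Proof. by apply: ip_inj => z; rewrite ipDl !opP ipDl. Qed.
Lemma opZ (f : op) (c : R[i]) x : f (c *: x) = c *: f x.
Proof. by apply: ip_inj => z; rewrite ipZl !opP ipZl. Qed.
Lemma op0 (f : op) : f 0 = 0.
Proof. by apply: ip_inj => z; rewrite !opP !ip0l. Qed.
Lemma opN (f : op) x : f (- x) = - f x.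
Proof. by apply: ip_inj => z; rewrite ipNl !opP ipNl. Qed.
Lemma opB (f : op) x y : f (x - y) = f x - f y.
Proof. by rewrite opD opN. Qed.

Definition star (f : op) : op.
Proof.
refine (@Op (opa f) f _ (opa_bounded f) (op_bounded f)).
by move=> x y; rewrite -opPr.
Defined.

Lemma bounded_fun0 : bounded_fun (fun=> 0).
Proof. by exists 0 => x; rewrite n2_0 mul0r. Qed.
Lemma bounded_funD f g : bounded_fun f -> bounded_fun g ->
  bounded_fun (fun x => f x + g x).
Proof.
move=> [c cP] [d dP]; exists (2 * c + 2 * d) => x.
by have := n2D_le (f x) (g x); have := cP x; have := dP x; lra.
Qed.
Lemma bounded_funZ (k : R[i]) f : bounded_fun f -> bounded_fun (fun x => k *: f x).
Proof.
move=> [c cP]; exists ((complex.Re k ^+ 2 + complex.Im k ^+ 2) * c) => x.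
by rewrite n2Z -mulrA ler_wpM2l// addr_ge0// sqr_ge0.
Qed.
Lemma bounded_funM f g : bounded_fun f -> bounded_fun g -> bounded_fun (f \o g).
Proof.
move=> /bounded_funP[c c0 cP] [d dP]; exists (c * d) => x /=.
by apply: le_trans (cP _) _; rewrite -mulrA ler_pM2l.
Qed.

Definition zero_op : op.
Proof.
refine (@Op (fun=> 0) (fun=> 0) _ bounded_fun0 bounded_fun0).
by move=> x y; rewrite ip0l ip0r.
Defined.
Definition one_op : op.
Proof.
refine (@Op id id (fun _ _ => erefl) _ _); exists 1 => x; by rewrite mul1r.
Defined.
Definition add_op (f g : op) : op.
Proof.
refine (@Op _ _ _ (bounded_funD (op_bounded f) (op_bounded g))
  (bounded_funD (opa_bounded f) (opa_bounded g))).
by move=> x y; rewrite ipDl ipDr !opP.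
Defined.
Definition scale_op (k : R[i]) (f : op) : op.
Proof.
refine (@Op _ _ _ (bounded_funZ k (op_bounded f))
  (bounded_funZ (k^*%C) (opa_bounded f))).
by move=> x y; rewrite ipZl ipZr conjcK opP.
Defined.
Definition mul_op (f g : op) : op.
Proof.
refine (@Op _ _ _ (bounded_funM (op_bounded f) (op_bounded g))
  (bounded_funM (opa_bounded g) (opa_bounded f))).
by move=> x y /=; rewrite !opP.
Defined.

HB.instance Definition _ := gen_eqMixin op.
HB.instance Definition _ := gen_choiceMixin op.

Fact add_opA : associative add_op.
Proof. by move=> f g h; apply: op_ext => x /=; rewrite addrA. Qed.
Fact add_opC : commutative add_op.
Proof. by move=> f g; apply: op_ext => x /=; rewrite addrC. Qed.
Fact add_0op : left_id zero_op add_op.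
Proof. by move=> f; apply: op_ext => x /=; rewrite add0r. Qed.
Fact add_Nop : left_inverse zero_op (scale_op (-1)) add_op.
Proof. by move=> f; apply: op_ext => x /=; rewrite scaleN1r addNr. Qed.
HB.instance Definition _ := GRing.isZmodule.Build op add_opA add_opC add_0op add_Nop.

Fact mul_opA : associative mul_op.
Proof. by move=> f g h; apply: op_ext. Qed.
Fact mul_1op : left_id one_op mul_op.
Proof. by move=> f; apply: op_ext. Qed.
Fact mul_op1 : right_id one_op mul_op.
Proof. by move=> f; apply: op_ext. Qed.
Fact mul_opDl : left_distributive mul_op add_op.
Proof. by move=> f g h; apply: op_ext. Qed.
Fact mul_opDr : right_distributive mul_op add_op.
Proof. by move=> f g h; apply: op_ext => x /=; rewrite opD. Qed.
HB.instance Definition _ :=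
  GRing.Zmodule_isPzRing.Build op mul_opA mul_1op mul_op1 mul_opDl mul_opDr.

Implicit Types f g h : op.

Lemma mulE f g x : (f * g) x = f (g x). Proof. by []. Qed.
Lemma addE f g x : (f + g) x = f x + g x. Proof. by []. Qed.
Lemma oppE f x : (- f) x = - f x. Proof. exact: scaleN1r. Qed.
Lemma oneE x : (1 : op) x = x. Proof. by []. Qed.
Lemma zeroE x : (0 : op) x = 0. Proof. by []. Qed.

Lemma starP f x y : ip (f x) y = ip x (star f y). Proof. exact: opP. Qed.
Lemma star_uniq f g : (forall x y, ip (f x) y = ip x (g y)) -> star f = g.
Proof.
by move=> h; apply: op_ext => y; apply: ip_injr => x; rewrite -starP h.
Qed.
Lemma starK f : star (star f) = f. Proof. exact: op_ext. Qed.
Lemma starM f g : star (f * g) = star g * star f. Proof. exact: op_ext. Qed.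
Lemma starD f g : star (f + g) = star f + star g. Proof. exact: op_ext. Qed.
Lemma starN f : star (- f) = - star f.
Proof. by apply: star_uniq => x y; rewrite !oppE ipNl ipNr starP. Qed.
Lemma starB f g : star (f - g) = star f - star g.
Proof. by rewrite starD starN. Qed.
Lemma star1 : star 1 = 1. Proof. exact: op_ext. Qed.
Lemma star0 : star 0 = 0. Proof. exact: op_ext. Qed.
Lemma starX f n : star (f ^+ n) = star f ^+ n.
Proof. by elim: n => [|n IH]; rewrite ?expr0 ?star1// exprS starM IH -exprSr. Qed.
Lemma star_sum I (r : seq I) (Q : pred I) (F : I -> op) :
  star (\sum_(i <- r | Q i) F i) = \sum_(i <- r | Q i) star (F i).
Proof. by apply: (big_morph star starD star0). Qed.

Definition injop f := forall x, f x = 0 -> x = 0.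

(** Cancelling an injective operator stands for applying its possibly unbounded inverse. *)
Lemma mul_injop f g h : injop f -> f * g = f * h -> g = h.
Proof.
move=> fi e; apply: op_ext => x; apply/eqP; rewrite -subr_eq0; apply/eqP/fi.
by rewrite opB -!mulE e subrr.
Qed.
Lemma mul_injop0 f g : injop f -> f * g = 0 -> g = 0.
Proof. by move=> fi e; apply: (mul_injop fi); rewrite e mulr0. Qed.
Lemma injopM f g : injop f -> injop g -> injop (f * g).
Proof. by move=> fi gi x /fi/gi. Qed.
Lemma injopX f n : injop f -> injop (f ^+ n).
Proof.
by move=> fi; elim: n => [|n IH] //; rewrite exprS; exact: injopM.
Qed.
Lemma star_mul_eq0 f : star f * f = 0 -> f = 0.
Proof.
move=> e; apply: op_ext => x; apply: n2_eq0; apply: complexI.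
by rewrite -ipxx starP -mulE e zeroE ip0r.
Qed.
Lemma n2_star f g x : star f * f = star g * g -> n2 (f x) = n2 (g x).
Proof.
by move=> e; apply: complexI; rewrite -!ipxx !starP -!mulE e.
Qed.
Lemma n2E f x : (n2 (f x))%:C = ip x ((star f * f) x).
Proof. by rewrite -ipxx starP. Qed.

(** A normal operator has the same kernel as its adjoint, so [g * (g * w) = 0] gives
    [star g * (g * w) = 0] and then [g * w = 0]; powers are dropped one at a time. *)
Lemma normal_exp_eq0 g f n : star g * g = g * star g -> g ^+ n.+1 * f = 0 -> g * f = 0.
Proof.
move=> gn; elim: n => [|n IH]; first by rewrite expr1.
rewrite 2!exprS -!mulrA => e; apply: IH; rewrite exprS -mulrA.
move: (g ^+ n * f) e => w e.
have e' : star g * (g * w) = 0.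
  by apply: star_mul_eq0; rewrite starM starK -mulrA (mulrA g) -gn -mulrA e !mulr0.
by apply: star_mul_eq0; rewrite starM -mulrA e' mulr0.
Qed.

Lemma op_continuous f (u : nat -> K) x : tends u x -> tends (f \o u) (f x).
Proof.
move=> ux e e0; have [c c0 cP] := bounded_funP (op_bounded f).
have [N HN] := ux _ (divr_gt0 e0 c0); exists N => k /HN h /=.
rewrite -opB; apply: le_lt_trans (cP _) _.
by rewrite mulrC -ltr_pdivlMr.
Qed.

Lemma tends_uniq (u : nat -> K) x y : tends u x -> tends u y -> x = y.
Proof.
move=> ux uy; apply/eqP; rewrite -subr_eq0; apply/eqP/n2_eq0.
apply: le_anti; rewrite n2_ge0 andbT; apply/ler_addgt0Pr => e e0; rewrite add0r.
have e4 : 0 < e / 4 by rewrite divr_gt0.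
have [N1 H1] := ux _ e4; have [N2 H2] := uy _ e4.
have := H1 (maxn N1 N2); have := H2 (maxn N1 N2).
rewrite leq_maxl leq_maxr => /(_ isT) h2 /(_ isT) h1.
have := n2D_le (x - u (maxn N1 N2)) (- (y - u (maxn N1 N2))).
by rewrite n2N opprB addrA subrK; lra.
Qed.

(** Such relations express quotients of bounded operators without mentioning a domain, in the form
    required by [projection]. *)
Lemma closed_intertwiner f g : closed_rel (fun x y => f x = g y).
Proof.
move=> u v x y uv ux vy; apply: tends_uniq (op_continuous f ux) _.
by rewrite (_ : f \o u = g \o v); [exact: op_continuous | exact/funext].
Qed.

Lemma linear_intertwiner f g : linear_rel (fun x y => f x = g y).
Proof. by split=> [|c x y x' y' e e']; rewrite ?op0// !opD !opZ e e'. Qed.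

End Operators.

(** * Normal operators as quotients of bounded operators *)

Section Relations.
Variables (R : realType) (K : hilbertType R).
Implicit Types (x y z : K) (b g : op K).

(** For the graph of [T], projecting [(y, 0)] gives [b = (1 + T*T)^-1] and [k = T b]; orthogonality
    says that [T*] sends [k y] to [y - b y]. Here [k] remains a plain function since [op] asks for
    an adjoint, which is built later from normality. *)
Lemma resolvent (G : K -> K -> Prop) : linear_rel G -> closed_rel G ->
  exists (b : op K) (k : K -> K), [/\ star b = b,
    forall y, G (b y) (k y),
    forall y w v, G w v -> ip (y - b y) w = ip (k y) v &
    forall y, n2 (k y) <= 1 * n2 y].
Proof.
move=> Glin Gcl.
have /choice[p Hp] (y : K) : exists p : K * K,
    G p.1 p.2 /\ forall w v, G w v -> ip (y - p.1) w = ip p.2 v.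
  have [p1 [p2 [Gp H]]] := projection y 0 Glin Gcl.
  exists (p1, p2); split=> // w v /H /eqP.
  by rewrite sub0r ipNl subr_eq0 => /eqP.
pose b y := (p y).1; pose k y := (p y).2.
have Gbk y : G (b y) (k y) by case: (Hp y).
have orth y w v : G w v -> ip (y - b y) w = ip (k y) v by case: (Hp y) => _; apply.
have n2bk y : n2 (b y) + 2 * n2 (k y) <= n2 y.
  have := congr1 (@complex.Re R) (orth y _ _ (Gbk y)).
  rewrite ipxx /= -/(rp _ _) rpDl rpNl rpxx => h.
  by have := n2_ge0 (y - b y); rewrite n2B; lra.
have bP x y : ip (b x) y = ip x (b y).
  have h u v : ip u (b v) = ip (b u) (b v) + ip (k u) (k v).
    by rewrite -(orth _ _ _ (Gbk v)) ipDl ipNl addrC subrK.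
  by rewrite [RHS]h ipC h rmorphD /= -!ipC.
have bb : bounded_fun b.
  by exists 1 => y; have := n2bk y; have := n2_ge0 (k y); lra.
exists (Op bP bb bb), k; split=> //; first exact: op_ext.
by move=> y; have := n2bk y; have := n2_ge0 (k y); have := n2_ge0 (b y); lra.
Qed.

(* [g b^-1] and [g* b^-1] are mutually adjoint. *)
Lemma quotient_adjoint b g x y x' z' : star b = b -> injop b -> g * b = b * g ->
  g x = b y -> star g x' = b z' -> ip y x' = ip x z'.
Proof.
move=> bs bi gb gxy gxz.
have gbs : star g * b = b * star g by rewrite -{1}bs -starM -gb starM bs.
(* Up to a rotation this is the graph of the quotient of [star g] by [b], the expected orthogonal
   complement of the graph of the quotient of [g]. The goal is that [(x, y)] projects to 0 on it. *)
pose G (u v : K) := star g (- v) = b u.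
have Glin : linear_rel G.
  have [h0 h] := linear_intertwiner b (- star g).
  split=> [|c u v u' v']; rewrite /G ?oppr0 ?op0// => e e'.
  by rewrite opprD -scalerN !opD !opZ e e'.
have Gcl : closed_rel G.
  move=> u v p q H up vq; rewrite /G opN -oppE.
  apply/esym; apply: (closed_intertwiner _ up vq) => k.
  by rewrite oppE -opN H.
have [z [w [Gzw H]]] := projection x y Glin Gcl.
(* The pairs [(- star g u, b u)] of [G] already force the residual into the quotient of [g]. *)
have rest : g (x - z) = b (y - w).
  apply/eqP; rewrite -subr_eq0; apply/eqP/ip_eq0 => u.
  rewrite ipDl ipNl !starP bs; apply/eqP; rewrite subr_eq0; apply/eqP.
  have /H : G (- star g u) (b u) by rewrite /G !opN -!mulE gbs.
  by rewrite ipNr => /eqP; rewrite addrC subr_eq0 => /eqP.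
have gzw : g z = b w.
  by have := rest; rewrite !opB gxy => /addrI/oppr_inj.
have z0 : z = 0.
  (* [(z, w)] lies in both graphs, so the positive operators [star g * g] and [b * b] take opposite
     values at [z]. *)
  have e : (star g * g + b * b) z = 0.
    rewrite addE !mulE gzw -(mulE (star g)) gbs mulE -Gzw.
    by rewrite opN opN addrN.
  have : n2 (g z) + n2 (b z) = 0.
    apply: complexI; rewrite rmorphD /= !n2E bs -ipDr -addE e ip0r.
    by [].
  move=> h; apply: bi; apply: n2_eq0.
  by have := n2_ge0 (g z); have := n2_ge0 (b z); lra.
have w0 : w = 0 by apply: bi; rewrite -gzw z0 op0.
have /H : G z' (- x') by rewrite /G opprK.
rewrite z0 w0 !subr0 ipNr => /eqP; rewrite subr_eq0 => /eqP.
by [].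
Qed.

(* The point [2q] comes from projecting [(y, 0)] on [{(p, q) | g* p = g q}]. *)
Lemma quotient_normal b g x y : star b = b -> injop b -> g * b = b * g ->
  star g * g = g * star g -> g x = b y ->
  exists2 z, star g x = b z & n2 z <= n2 y.
Proof.
move=> bs bi gb gn gxy.
have gbs : star g * b = b * star g by rewrite -{1}bs -starM -gb starM bs.
have [p [q [pq H]]] :=
  projection y 0 (linear_intertwiner (star g) g) (@closed_intertwiner _ _ (star g) g).
exists (q + q); last first.
  (* Testing orthogonality on [(p, q)] itself gives [rp (y - p) p = n2 q], whence
     [n2 (y - 2p) = n2 y - 4 n2 q]. *)
  have /(congr1 (@complex.Re R)) := H _ _ pq.
  rewrite sub0r ipNl raddfB /= -/(rp _ _) -/(rp _ _) rpxx rpDl rpNl rpxx => h.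
  have := n2_ge0 (y - (p + p)); rewrite n2B n2D rpDr !rpxx n2D rpxx; lra.
have ker_orth k : g k = 0 -> ip q k = 0.
  move=> gk0; have := H 0 k; rewrite op0 gk0 => /(_ erefl).
  by rewrite ip0r add0r sub0r ipNl => /eqP; rewrite oppr_eq0 => /eqP.
have gqq : g (q + q) = star g y.
  (* By normality all pairs [(g u, star g u)] belong to the relation; orthogonality to them is this
     equation. *)
  have e : star g (y - p) = g q.
    apply: ip_inj => u; rewrite starP starK [RHS]starP.
    have := H (g u) (star g u); rewrite -!mulE gn => /(_ erefl) /eqP.
    by rewrite sub0r ipNl subr_eq0 => /eqP.
  by rewrite opD -[X in X + _]e opB -pq subrK.
apply/eqP; rewrite -subr_eq0; apply/eqP/n2_eq0; apply: complexI.
(* [k] is in the kernel of [g], which [b] preserves and to which [q] is orthogonal; hence [k] is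
   orthogonal to itself. *)
set k := star g x - b (q + q).
have gk0 : g k = 0.
  by rewrite /k opB -!mulE -gn gb !mulE gxy gqq -!mulE gbs subrr.
have gbk0 : g (b k) = 0 by rewrite -mulE gb mulE gk0 op0.
rewrite -ipxx {1}/k ipDl ipNl !starP starK bs gk0 ip0r ipDl !ker_orth//.
by rewrite addr0 oppr0 addr0.
Qed.

End Relations.

(** * Encoding of normal operators by pairs of bounded operators *)

Section Normal.
Variables (R : realType) (K : hilbertType R).
Implicit Types (x y z : K) (b g : op K) (T : partial_op K).

Definition graph T x y := dom T x /\ T x = y.

Lemma closed_op_rel T : closed_op T -> closed_rel (graph T).
Proof.
move=> Tcl u v x y uv ux vy.
suff : op_graph T (x, y) by case=> /= ? ->.
have -> : op_graph T = closure (op_graph T) by apply/closure_id.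
move=> B /nbhs_ballP[e e0 eB].
have [e1 [e1_0 eE]] : exists e1 : R, 0 < e1 /\ e = e1%:C.
  have eE : e = (complex.Re e)%:C by rewrite RRe_real// gtr0_real.
  by exists (complex.Re e); split=> //; rewrite -ltcR -eE.
have [N1 H1] := ux _ (exprn_gt0 2 e1_0); have [N2 H2] := vy _ (exprn_gt0 2 e1_0).
pose k := maxn N1 N2.
exists (u k, v k); split; first by case: (uv k) => ? <-.
apply: eB; split; rewrite -ball_normE /= eE -norm_lt_n2//.
  by apply: H1; rewrite leq_maxl.
by apply: H2; rewrite leq_maxr.
Qed.

Lemma linear_op_rel T : linear_op T -> linear_rel (graph T).
Proof.
move=> [T0 Tlin]; split.
  split=> //; have [_] := Tlin (-1) _ _ T0 T0.
  by rewrite scaleN1r scaleN1r !addNr.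
by move=> c x y x' y' [dx <-] [dx' <-]; have [] := Tlin c _ _ dx dx'.
Qed.

(** Otherwise some point of [A] would be closer to [x] than 0 is, against Pythagoras. *)
Lemma dense_ip_eq0 (A : set K) x : dense A -> (forall y, A y -> ip y x = 0) -> x = 0.
Proof.
move=> Ad H; apply: contrapT => x0.
have r0 : 0 < n2 x.
  by rewrite lt_neqAle n2_ge0 andbT eq_sym; apply/eqP => /n2_eq0.
have s0 : 0 < Num.sqrt (n2 x) by rewrite sqrtr_gt0.
have [] := Ad (ball x (Num.sqrt (n2 x))%:C).
- by exists x; apply: ballxx; rewrite ltcR.
- by apply: ball_open; rewrite ltcR.
move=> y []; rewrite -ball_normE /= -norm_lt_n2// sqr_sqrtr ?ltW//.
rewrite n2B => lt /H h; have : rp x y = 0 by rewrite rpC /rp h.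
by have := n2_ge0 y; lra.
Qed.

(** Density makes the adjoint value unique, so the choice made by [xget] is the given value and its
    default 0 does not occur on the domain. *)
Lemma adjoint_graph T y z : dense (dom T) ->
  graph (adjoint T) y z <-> is_adjoint_value T y z.
Proof.
move=> Td; split=> [[[w wP] <-]|zP]; first by apply: xgetPex; exists w.
split; first by exists z.
have h : is_adjoint_value T y (adjoint T y) by apply: xgetPex; exists z.
apply/eqP; rewrite -subr_eq0; apply/eqP; apply: (dense_ip_eq0 Td) => x dx.
by rewrite ipDr ipNr /ip -h// -zP// subrr.
Qed.

(* A normal operator T is encoded by bounded operators: b = (1 + T*T)^-1
   and g = T b, so that T is the quotient [g b^-1]. *)
Definition normal_pair b g := [/\ star b = b, injop b, g * b = b * g,
  star g * g = b * (1 - b) & g * star g = b * (1 - b)].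

Definition represents T b g := forall x y, graph T x y <-> g x = b y.

(** [b] and [T b] come from the resolvent of the graph. Normality puts the range of [b] in the
    domain of [T T*], so that [T* b] is defined everywhere and is the adjoint of [T b]. *)
Lemma normal_op_represents T : normal_op T ->
  exists b g, normal_pair b g /\ represents T b g.
Proof.
move=> [Tlin Td Tcl [domE appE]]; set A := adjoint T.
have Grel := linear_op_rel Tlin; have Gcl := closed_op_rel Tcl.
have [b [k [bs Gbk orth kb]]] := resolvent Grel Gcl.
have domb y : dom T (b y) by case: (Gbk y).
have kE y : T (b y) = k y by case: (Gbk y).
have Gk y : graph A (k y) (y - b y).
  apply/(adjoint_graph _ _ Td) => w dw.
  have /(congr1 (@conjc R)) := orth y w (T w) (conj dw erefl).
  by rewrite -!ipC.
have domAT y : dom (op_comp A T) (b y).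
  by split=> //; rewrite kE; case: (Gk y).
have domTA y : dom (op_comp T A) (b y) by rewrite domE.
have AP w v x : dom T w -> graph A x v -> ip (T w) x = ip w v.
  by move=> dw /(adjoint_graph _ _ Td); exact.
pose k' y := A (b y).
have Gk' y : graph A (b y) (k' y) by split=> //; case: (domTA y).
have Tk' y : graph T (k' y) (y - b y).
  split; first by case: (domTA y).
  have := appE _ (domTA y); rewrite /= -/(k' y) => ->.
  by rewrite kE; case: (Gk y).
have gP x y : ip (k x) y = ip x (k' y).
  have yE : y = b y + T (k' y) by case: (Tk' y) => _ ->; rewrite addrC subrK.
  rewrite {1}yE ipDr -{1}kE (AP _ _ _ (domb x) (Gk' y)) [X in _ + X]ipC.
  rewrite (AP _ _ _ _ (Gk x)); last by case: (Tk' y).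
  by rewrite -ipC ipDl ipNl addrC subrK.
have kb' : bounded_fun k'.
  exists 1 => y; suff -> : n2 (k' y) = n2 (k y) by [].
  apply: complexI; rewrite -!ipxx -(orth y _ _ (Gbk y)).
  have := AP _ _ _ _ (Gk' y) => <-; last by case: (Tk' y).
  by case: (Tk' y) => _ ->.
pose g := Op gP (ex_intro _ 1 kb) kb'.
have Tb w : dom T w -> g w = b (T w).
  move=> dw; apply: ip_inj => u; rewrite starP [RHS]starP bs.
  by rewrite (AP _ _ _ dw (Gk' u)).
have Ab w v : graph A w v -> star g w = b v.
  move=> Gw; apply: ip_inj => u; rewrite starP starK [RHS]starP bs.
  by rewrite ipC [RHS]ipC -(AP _ _ _ (domb u) Gw) kE.
have bi : injop b.
  move=> y by0; apply: (dense_ip_eq0 Td) => w dw; rewrite ipC.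
  have := orth y w (T w) (conj dw erefl).
  rewrite -kE by0 subr0 => ->; case: (Grel) => -[_ ->] _.
  by rewrite ip0l conjc0.
have gb : g * b = b * g.
  by apply: op_ext => y; rewrite mulE Tb// kE.
have np : normal_pair b g.
  split=> //; apply: op_ext => y; rewrite !mulE addE oppE oneE.
    exact: Ab (Gk y).
  by rewrite Tb; case: (Tk' y) => // _ ->.
exists b, g; split=> // x y; split=> [[dx <-]|gxy]; first exact: Tb.
(* For the converse inclusion, the residual of [(x, y)] is in the quotient ([e1]) and orthogonal to
   the graph ([e2]); together these give [b (x - p) = 0]. *)
have [p [q [[dp Tp] H]]] := projection x y Grel Gcl.
have gpq : g p = b q by rewrite Tb// Tp.
have e1 : g (x - p) = b (y - q) by rewrite !opB gxy gpq.
have e2 : b (x - p) = - star g (y - q).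
  apply/eqP; rewrite -addr_eq0; apply/eqP/ip_eq0 => u.
  by rewrite ipDl !starP starK bs; exact: H.
have [_ _ _ gg _] := np.
have gbs : star g * b = b * star g by rewrite -{1}bs -starM -gb starM bs.
have x0 : x - p = 0.
  apply: bi; have : b (b (x - p)) = b (b (x - p)) - b (x - p).
    rewrite {1}e2 opN -mulE -gbs mulE -e1 -mulE gg mulE addE oppE oneE.
    by rewrite (opB b) opprB.
  by move/eqP; rewrite -subr_eq0 opprB addrC subrK => /eqP.
have y0 : y - q = 0 by apply: bi; rewrite -e1 x0 op0.
by move/eqP: x0; move/eqP: y0; rewrite !subr_eq0 => /eqP -> /eqP ->.
Qed.

(** By [quotient_adjoint] the pair [b], [star g] represents the adjoint, and [quotient_normal]
    passes from [T] to the adjoint at the same vector; cancelling [b] exchanges the order of the two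
    operators. *)
Lemma represents_normal_op T b g : linear_op T -> dense (dom T) -> closed_op T ->
  normal_pair b g -> represents T b g -> normal_op T.
Proof.
move=> Tlin Td Tcl [bs bi gb gg' g'g] TG; split=> //.
have gn : star g * g = g * star g by rewrite gg' g'g.
have gbs : star g * b = b * star g by rewrite -{1}bs -starM -gb starM bs.
have AG x z : graph (adjoint T) x z <-> star g x = b z.
  rewrite (adjoint_graph _ _ Td); split=> [h|h w dw].
    apply: ip_injr => u; rewrite -starP -[in RHS]bs -starP.
    have /TG[du <-] : g (b u) = b (g u) by rewrite -!mulE gb.
    exact: h.
  have /TG h' : graph T w (T w) by [].
  exact: quotient_adjoint h' h.
have AT x t : graph (op_comp (adjoint T) T) x t -> graph (op_comp T (adjoint T)) x t.
  move=> [[dx dTx] /= ATx].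
  have /TG gx : graph T x (T x) by [].
  have /AG gTx : graph (adjoint T) (T x) t by [].
  have [z gz _] := quotient_normal bs bi gb gn gx.
  have /TG Tz : g z = b t.
    apply/eqP; rewrite -subr_eq0; apply/eqP/bi; rewrite opB -!mulE -gb !mulE -gz.
    by rewrite -(mulE g) -gn mulE gx -mulE gbs !mulE gTx subrr.
  have /AG [dAx Ax] := gz; case: Tz => dz Tz.
  by split; [split; rewrite ?Ax | exact: etrans (congr1 T Ax) Tz].
have TA x t : graph (op_comp T (adjoint T)) x t -> graph (op_comp (adjoint T) T) x t.
  move=> [[dx dAx] /= TAx].
  have /AG gx : graph (adjoint T) x (adjoint T x) by [].
  have /TG gTx : graph T (adjoint T x) t by [].
  have [|z gz _] := quotient_normal bs bi gbs _ gx; first by rewrite starK gn.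
  rewrite starK in gz.
  have /AG Az : star g z = b t.
    apply/eqP; rewrite -subr_eq0; apply/eqP/bi; rewrite opB -!mulE -gbs !mulE -gz.
    by rewrite -(mulE (star g)) gn mulE gx -mulE gb !mulE gTx subrr.
  have /TG [dTx Tx] := gz; case: Az => dz Az.
  by split; [split; rewrite ?Tx | exact: etrans (congr1 (adjoint T) Tx) Az].
have ext x : dom (op_comp T (adjoint T)) x <-> dom (op_comp (adjoint T) T) x.
  split=> d; first by case: (TA x (T (adjoint T x))).
  by case: (AT x (adjoint T (T x))).
split; first by apply/seteqP; split=> x /ext.
by move=> x d; case: (TA x _ (conj d erefl)).
Qed.

End Normal.

(** * Roots of positive operators *)

Section Roots.
Variable R : realType.

(** ['X^n - 1] splits over [R[i]] and is separable in characteristic 0. *)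
Lemma prim_root_exists n : (0 < n)%N -> exists z : R[i], n.-primitive_root z.
Proof.
move=> n0; pose p : {poly R[i]} := 'X^n - 1.
have pm : p \is monic by rewrite monicXnsubC.
have sp : size p = n.+1 by rewrite size_XnsubC.
have [rs prs] := closed_field_poly_normal p.
rewrite (monicP pm) scale1r in prs.
have srs : size rs = n by have := sp; rewrite prs size_prod_XsubC => -[].
have all_rs : all n.-unity_root rs.
  by apply/allP => x xrs; rewrite /root_of_unity -/p prs root_prod_XsubC.
have urs : uniq rs.
  rewrite -separable_prod_XsubC -prs separable_Xn_sub_1//.
  by rewrite pnatr_eq0 -lt0n.
have [|x _ xz] := hasP (has_prim_root n0 all_rs urs _); first by rewrite srs.
by exists x.
Qed.

(** The powers of [w] sum to 0 and the power of exponent 0 contributes 1, so they cannot all have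
    positive real part. *)
Lemma unity_root_Re_le0 (w : R[i]) n : (0 < n)%N -> w ^+ n = 1 -> w != 1 ->
  exists2 m, (m < n)%N & complex.Re (w ^+ m) <= 0.
Proof.
move=> n0 wn w1.
have s0 : \sum_(i < n) w ^+ i = 0.
  by apply/eqP; have := subrX1 w n; rewrite wn subrr => /esym/eqP;
    rewrite mulf_eq0 subr_eq0 (negPf w1).
apply: contrapT => h.
have pos m : (m < n)%N -> 0 < complex.Re (w ^+ m).
  by move=> mn; rewrite ltNge; apply/negP => le; apply: h; exists m.
case: n n0 wn s0 {h} pos => [//|n] _ _.
move=> /(congr1 (@complex.Re R)) /eqP; rewrite raddf_sum /= => /eqP s0 pos.
have := s0; apply/eqP; rewrite gt_eqF// big_ord_recl.
rewrite ltr_pwDl ?pos// sumr_ge0// => i _.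
by rewrite ltW// pos// lift0 ltnS.
Qed.

Lemma unity_root_norm (w : R[i]) n : (0 < n)%N -> w ^+ n = 1 ->
  complex.Re w ^+ 2 + complex.Im w ^+ 2 = 1.
Proof.
move=> n0 wn; apply: complexI; rewrite add_Re2_Im2.
have /eqP := congr1 Num.norm wn.
by rewrite normrX normr1 pexpr_eq1// => /eqP ->; rewrite expr1n.
Qed.

End Roots.

(** * Commutation with a positive operator from commutation with its power *)

Section PositiveRoots.
Variables (R : realType) (K : hilbertType R).
Implicit Types (x y z : K) (f g : op K) (w : R[i]).

Definition sc w : op K := scale_op w 1.

Lemma scE w x : sc w x = w *: x. Proof. by []. Qed.
Lemma scC w f : f * sc w = sc w * f.
Proof. by apply: op_ext => x; rewrite !mulE !scE opZ. Qed.
Lemma sc1 : sc 1 = 1. Proof. by apply: op_ext => x; rewrite scE scale1r. Qed.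
Lemma scM v w : sc (v * w) = sc v * sc w.
Proof. by apply: op_ext => x; rewrite mulE !scE scalerA. Qed.

Lemma scD v w : sc (v + w) = sc v + sc w.
Proof. by apply: op_ext => x; rewrite addE !scE scalerDl. Qed.
Lemma sc0 : sc 0 = 0.
Proof. by apply: op_ext => x; rewrite scE scale0r. Qed.
Lemma sc_sum n (F : nat -> R[i]) : sc (\sum_(i < n) F i) = \sum_(i < n) sc (F i).
Proof. exact: (big_morph sc scD sc0). Qed.
Lemma sc_nat n : sc n%:R = n%:R.
Proof. by elim: n => [|n IH]; rewrite ?sc0// !mulrS scD sc1 IH. Qed.

Lemma mulrn_inj n f g : (0 < n)%N -> f *+ n = g *+ n -> f = g.
Proof.
move=> n0 e; apply: op_ext => x.
have scn h : h *+ n = sc n%:R * h by rewrite sc_nat mulr_natl.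
have : (f *+ n) x = (g *+ n) x by rewrite e.
rewrite !scn !mulE !scE.
by apply: scalerI; rewrite pnatr_eq0 -lt0n.
Qed.

(* If [D] is positive and [w] has modulus 1 and nonpositive real part, then
   [1 - t D] is a contraction for small [t > 0] whereas the [k]-th power of
   [1 - t w D] stretches [z] at least by [n2 z + k t^2 n2 (D z)]. *)
Lemma rotated_positive_eq0 q D Y w : D = star q * q ->
  complex.Re w ^+ 2 + complex.Im w ^+ 2 = 1 -> complex.Re w <= 0 ->
  Y * D = sc w * D * Y -> D * Y = 0.
Proof.
move=> Dq w1 w0 YD.
have [c c0 cP] := bounded_funP (op_bounded (star q)).
have [d d0 dP] := bounded_funP (op_bounded Y).
(* Since [c] bounds [star q], one has [n2 (D z) <= c * n2 (q z)], which makes [1 - t D] a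
   contraction for this [t]. *)
pose t := c^-1; have t0 : 0 < t by rewrite invr_gt0.
pose A := 1 - sc t%:C * D; pose B := 1 - sc t%:C * sc w * D.
have YA : Y * A = B * Y.
  rewrite /A /B mulrBr mulrBl mulr1 mul1r; congr (_ - _).
  by rewrite mulrA (scC _ Y) -!mulrA YD -!mulrA.
have YAk k : Y * A ^+ k = B ^+ k * Y.
  by elim: k => [|k IH]; rewrite ?mulr1 ?mul1r// exprSr mulrA IH -(mulrA _ Y) YA mulrA -exprSr.
have ipD z : ip z (D z) = (n2 (q z))%:C by rewrite Dq n2E.
have n2D z : n2 (D z) <= c * n2 (q z) by rewrite Dq mulE.
have AE z : A z = z - t%:C *: D z by rewrite addE oppE mulE scE.
have BE z : B z = z - t%:C *: (w *: D z) by rewrite addE oppE !mulE !scE.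
have n2A z : n2 (A z) <= n2 z.
  rewrite AE n2B n2ZR rpZr /rp ipD /=.
  have : t ^+ 2 * n2 (D z) <= t * n2 (q z).
    rewrite expr2 -mulrA ler_pM2l// /t mulrC ler_pdivrMr//.
    by rewrite mulrC.
  have : 0 <= t * n2 (q z) by rewrite mulr_ge0 ?n2_ge0// ltW.
  lra.
have n2B z : n2 z + t ^+ 2 * n2 (D z) <= n2 (B z).
  rewrite BE n2B n2ZR rpZr n2Z w1 mul1r /rp ipZr ipD /= .
  have -> : complex.Re (w^*%C * (n2 (q z))%:C) = complex.Re w * n2 (q z).
    by case: (w) => a b /=; rewrite mulr0 subr0.
  have : t * (complex.Re w * n2 (q z)) <= 0.
    by rewrite mulr_ge0_le0 ?mulr_le0_ge0 ?n2_ge0// ltW.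
  lra.
have DB z : D (B z) = B (D z) by rewrite !BE opB !opZ.
have n2Ak k z : n2 ((A ^+ k) z) <= n2 z.
  elim: k => [|k IH]; first by rewrite expr0.
  by rewrite exprS mulE; apply: le_trans (n2A _) IH.
have n2Bk k z : n2 z + k%:R * (t ^+ 2 * n2 (D z)) <= n2 ((B ^+ k) z).
  elim: k z => [|k IH] z; first by rewrite mul0r addr0.
  rewrite (exprSr B) mulE; apply: le_trans (IH _).
  rewrite -natr1 mulrDl mul1r.
  have h : k%:R * (t ^+ 2 * n2 (D z)) <= k%:R * (t ^+ 2 * n2 (D (B z))).
    rewrite !ler_wpM2l ?ler0n ?sqr_ge0// DB.
    by apply: le_trans (n2B _); rewrite lerDl mulr_ge0 ?sqr_ge0 ?n2_ge0.
  by have := n2B z; lra.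
apply: op_ext => x; rewrite mulE; apply: n2_eq0; apply: contrapT => /eqP r0.
set r := n2 _ in r0.
have {}r0 : 0 < t ^+ 2 * r.
  by rewrite mulr_gt0 ?exprn_gt0// lt_neqAle eq_sym r0 n2_ge0.
(* [k] is taken so large that [k t^2 n2 (D (Y x))] exceeds the bound [d * n2 x] valid for
   [Y ((A ^+ k) x)]. *)
pose k := (Num.truncn (d * n2 x / (t ^+ 2 * r))).+1.
have : k%:R * (t ^+ 2 * r) <= d * n2 x.
  have e : (B ^+ k) (Y x) = Y ((A ^+ k) x).
    exact: esym (congr1 (fun f : op K => f x) (YAk k)).
  have := n2Bk k (Y x); rewrite e -/r => h.
  have := dP ((A ^+ k) x); have := n2_ge0 (Y x).
  have : d * n2 ((A ^+ k) x) <= d * n2 x by rewrite ler_pM2l.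
  lra.
by rewrite -ler_pdivlMr// leNgt truncnS_gt.
Qed.

(** The components [Y l] with [l <> 0] are killed by [X ^+ n], and all of them sum to [n P X^(n-1)].
    Hence [X] commutes with [X^n P X^(n-1)], and self-adjointness of [X] removes the extra
    powers. *)
Lemma positive_root_commute (X P h : op K) n : X = star h * h -> star P = P -> (0 < n)%N ->
  X ^+ n * P = P * X ^+ n -> X * P = P * X.
Proof.
move=> Xh Ps n0 XnP.
have Xs : star X = X by rewrite Xh starM starK.
have [z zprim] := prim_root_exists R n0.
pose F (l j : nat) := sc (z ^+ (l * j)) * (X ^+ j * P * X ^+ (n - j)).
pose Y (l : nat) := \sum_(j < n) sc (z ^+ (l * j)) * (X ^+ j * P * X ^+ (n.-1 - j)).
have zn l : (z ^+ l) ^+ n = 1 by rewrite exprAC (prim_expr_order zprim) expr1n.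
have YX l : Y l * X = sc (z ^+ l) * X * Y l.
  have -> : Y l * X = \sum_(j < n) F l j.
    rewrite mulr_suml; apply: eq_bigr => j _; rewrite /F.
    have -> : (n - j)%N = (n.-1 - j).+1 by have := ltn_ord j; lia.
    by rewrite (exprSr X) -!mulrA.
  have -> : sc (z ^+ l) * X * Y l = \sum_(j < n) F l j.+1.
    rewrite mulr_sumr; apply: eq_bigr => j _.
    rewrite /F mulnS exprD scM (exprS X).
    have -> : (n - j.+1)%N = (n.-1 - j)%N by lia.
    by rewrite -!mulrA; congr (_ * _); rewrite mulrA (scC _ X) -mulrA.
  (* The two sums differ by a cyclic shift: the terms of index 0 and [n] agree, by [XnP] and
     [z^(l n) = 1]. *)
  have : \sum_(j < n.+1) F l j = \sum_(j < n.+1) F l j by [].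
  rewrite {1}big_ord_recr big_ord_recl /= => e.
  apply: (addIr (F l n)); rewrite e addrC; congr (_ + _).
  rewrite /F muln0 expr0 subnn exprM zn sc1 !expr0 subn0 mul1r mulr1 mul1r mul1r.
  by rewrite XnP.
have YXm l m : Y l * X ^+ m = sc ((z ^+ l) ^+ m) * X ^+ m * Y l.
  elim: m => [|m IH]; first by rewrite !expr0 sc1 !mul1r mulr1.
  rewrite exprSr mulrA IH -mulrA YX !exprSr scM -!mulrA; congr (_ * _).
  by rewrite !mulrA scC.
have Y0 (l : 'I_n) : l != 0%N :> nat -> X ^+ n * Y l = 0.
  move=> l0.
  have zl1 : z ^+ l != 1.
    rewrite -(prim_order_dvd zprim); apply/negP => /dvdn_leq.
    by rewrite lt0n l0 leqNgt ltn_ord => /(_ isT).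
  have [m mn Re0] := unity_root_Re_le0 n0 (zn l) zl1.
  have XmY : X ^+ m * Y l = 0.
    have [q qE] : exists q, X ^+ m = star q * q.
      (* An odd power of [X] has one factor [X = star h * h] in the middle. *)
      exists (if odd m then h * X ^+ m./2 else X ^+ m./2).
      rewrite -{1}(odd_double_half m) -addnn.
      case: (odd m); rewrite ?starM starX Xs -?exprD ?add0n//.
      by rewrite -!mulrA (mulrA (star h)) -Xh -exprS -exprD addnS.
    apply: (rotated_positive_eq0 qE _ Re0 (YXm l m)).
    by apply: (@unity_root_norm _ _ n) => //; rewrite exprAC zn expr1n.
  have -> : X ^+ n = X ^+ (n - m) * X ^+ m by rewrite -exprD subnK// ltnW.
  by rewrite -mulrA XmY mulr0.
(* Summing the characters [z^(l j)] over [l] leaves only [j = 0]. *)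
have sumY : \sum_(l < n) Y l = P * X ^+ n.-1 *+ n.
  rewrite /Y exchange_big /=.
  transitivity (\sum_(j < n) sc (\sum_(l < n) z ^+ (l * j)) * (X ^+ j * P * X ^+ (n.-1 - j))).
    by apply: eq_bigr => j _; rewrite -mulr_suml (sc_sum n (fun l => z ^+ (l * j))).
  case: (n) n0 zprim zn => // n' _ zprim zn; rewrite big_ord_recl [X in _ + X]big1 ?addr0 /=.
    have -> : \sum_(l < n'.+1) z ^+ (l * 0) = n'.+1%:R.
      by rewrite (eq_bigr (fun=> 1)) ?sumr_const ?card_ord// => l _; rewrite muln0.
    by rewrite sc_nat expr0 mul1r subn0 mulr_natl.
  move=> j _; suff -> : \sum_(l < n'.+1) z ^+ (l * lift ord0 j) = 0.
    by rewrite sc0 mul0r.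
  have zj1 : z ^+ lift ord0 j != 1.
    rewrite -(prim_order_dvd zprim); apply/negP => /dvdn_leq.
    by move=> /(_ isT); rewrite leqNgt ltn_ord.
  under eq_bigr do rewrite mulnC exprM.
  apply/eqP; have := subrX1 (z ^+ lift ord0 j) n'.+1.
  by rewrite zn subrr => /esym/eqP; rewrite mulf_eq0 subr_eq0 (negPf zj1).
have XnY : (X ^+ n * (P * X ^+ n.-1)) *+ n = X ^+ n * Y 0%N.
  rewrite -mulrnAr -sumY mulr_sumr.
  by rewrite (bigD1 (Ordinal n0))//= [X in _ + X]big1 ?addr0// => l /Y0.
have main : X * (X ^+ n * (P * X ^+ n.-1)) = X ^+ n * (P * X ^+ n.-1) * X.
  apply: (mulrn_inj n0); rewrite -(mulrnAr X) -(mulrnAl _ X) XnY -mulrA YX.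
  by rewrite expr0 sc1 mul1r !mulrA -exprS -exprSr.
(* The commutator is skew-adjoint and satisfies [Z X^(2n-1) = 0]. Taking adjoints and dropping
   powers gives [X Z = 0] and [X P Z = 0], so [star Z * Z = 0]. *)
pose Z := X * P - P * X.
have Zs : star Z = - Z by rewrite starB !starM Xs Ps opprB.
have ZX : Z * X ^+ (n + n.-1) = 0.
  rewrite mulrBl exprD; apply/eqP; rewrite subr_eq0; apply/eqP.
  have -> : X * P * (X ^+ n * X ^+ n.-1) = X * (X ^+ n * (P * X ^+ n.-1)).
    by rewrite (mulrA _ P) XnP -!mulrA.
  rewrite main (mulrA _ P) XnP -!mulrA -exprSr; congr (_ * _).
  by rewrite -!exprD -exprS; congr (_ ^+ _); lia.
have XZ : X * Z = 0.
  apply: (@normal_exp_eq0 _ _ _ _ (n + n.-1).-1); first by rewrite Xs.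
  rewrite prednK; last by rewrite addn_gt0 n0.
  have /(congr1 (@star _ _)) := ZX.
  by rewrite starM starX Xs Zs star0 mulrN => /eqP; rewrite oppr_eq0 => /eqP.
have XPZ : X * (P * Z) = 0.
  apply: (@normal_exp_eq0 _ _ _ _ n.-1); first by rewrite Xs.
  by rewrite prednK// mulrA XnP -mulrA -(prednK n0) exprSr -mulrA XZ !mulr0.
have : Z = 0.
  apply: star_mul_eq0; rewrite Zs /Z opprB mulrBl -/Z -!mulrA XZ XPZ.
  by rewrite mulr0 subrr.
by move/eqP; rewrite subr_eq0 => /eqP.
Qed.

End PositiveRoots.

(** * Reducing subspaces *)

(* In the application N is the normal extension of T, b = (1 + N*N)^-1,
   g = N b, and P is the projection onto H; with S = T^n, the operators r and s
   are (1 + S*S)^-1 P and S (1 + S*S)^-1 P. *)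
Section Reducing.
Variables (R : realType) (K : hilbertType R).
Variables (b g P r s : op K) (n : nat).
Hypotheses (n0 : (0 < n)%N) (bg : normal_pair b g).
Hypotheses (Ps : star P = P) (PP : P * P = P).
Hypotheses (rs : star r = r) (Pr : P * r = r).
Hypothesis rI : forall f, r * f = 0 -> P * f = 0.
Hypotheses (sP : s * P = s) (ss : star s * s = r - r * r) (rsC : r * s = s * r).
Hypotheses (bs : b ^+ n * s = g ^+ n * r) (bs' : b ^+ n * star s = star g ^+ n * r).

Let a := 1 - b.
(** As [a = N*N b], this is [(1 + (N*N)^n) b^n]. *)
Let E := a ^+ n + b ^+ n.
Let bS : star b = b. Proof. by case: bg. Qed.
Let bI : injop b. Proof. by case: bg. Qed.
Let gb : g * b = b * g. Proof. by case: bg. Qed.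
Let gg : star g * g = b * a. Proof. by case: bg. Qed.
Let gn : star g * g = g * star g. Proof. by case: bg => _ _ _ -> ->. Qed.
Let gbs : star g * b = b * star g.
Proof. by rewrite -{1}bS -starM -gb starM bS. Qed.
Let rP : r * P = r. Proof. by rewrite -{1}rs -Ps -starM Pr. Qed.

Let comm_a f : GRing.comm f b -> GRing.comm f a.
Proof. by move=> fb; apply: commrB => //; exact: commr1. Qed.
Let comm_E f : GRing.comm f b -> GRing.comm f E.
Proof. by move=> fb; apply: commrD; apply: commrX => //; exact: comm_a. Qed.
Let ab : GRing.comm a b. Proof. by apply/commr_sym/comm_a. Qed.
Let bnI : injop (b ^+ n). Proof. exact: injopX. Qed.
Let ggn : star g ^+ n * g ^+ n = b ^+ n * a ^+ n.
Proof. by rewrite -!exprMn_comm ?gg//; exact: commr_sym. Qed.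
Let gsbn : star g ^+ n * b ^+ n = b ^+ n * star g ^+ n.
Proof. by apply/commrX/commr_sym/commrX/commr_sym. Qed.

(** [b ^+ n * E] is the sum of the positive operators [star g ^+ n * g ^+ n] and
    [b ^+ n * b ^+ n]. *)
Lemma injE : injop E.
Proof.
move=> x Ex.
have : n2 ((g ^+ n) x) + n2 ((b ^+ n) x) = 0.
  apply: complexI; rewrite rmorphD /= !n2E !starX bS ggn -ipDr -addE -mulrDr.
  by rewrite -/E mulE Ex op0 ip0r.
move=> h; apply: bnI; apply: n2_eq0.
by have := n2_ge0 ((g ^+ n) x); have := n2_ge0 ((b ^+ n) x); lra.
Qed.

(** This says [(1 + (N*N)^n) r = P], because on the range of [r] the power [N^n] and its adjoint are
    given by [s] and [star s]. A right factor [r] is removed at the end by taking adjoints and using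
    [rI]. *)
Lemma resolvent_compression : E * r = b ^+ n * P.
Proof.
have h : b ^+ n * (r - r * r) = a ^+ n * (r * r).
  apply: (mul_injop bnI).
  have -> : b ^+ n * (r - r * r) = star g ^+ n * (r * s).
    by rewrite -ss mulrA bs' mulrA.
  by rewrite mulrA -gsbn rsC -mulrA (mulrA (b ^+ n)) bs mulrA mulrA ggn -!mulrA.
pose F := b ^+ n * P - E * r.
have Fr : F * r = 0.
  rewrite mulrBl -!mulrA Pr /E mulrDl -h mulrBr subrK subrr.
  by [].
have : P * star F = 0.
  by apply: rI; rewrite -[in LHS]rs -starM Fr star0.
move=> /(congr1 (@star _ _)); rewrite starM starK Ps star0 mulrBl -!mulrA PP rP.
by move/eqP; rewrite subr_eq0 => /eqP.
Qed.

(* C is (1 + N*^n N^n)^-1, obtained by projecting on the graph of N^n. *)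
Lemma resolvent_exists : exists2 C : op K, star C = C & E * C = b ^+ n.
Proof.
have [C [k [Cs CG CH _]]] := resolvent (linear_intertwiner (g ^+ n) (b ^+ n))
  (@closed_intertwiner _ _ (g ^+ n) (b ^+ n)).
exists C => //; apply: op_ext => y.
have e : (b ^+ n) (y - C y) = (star g ^+ n) (k y).
  apply: ip_inj => u; rewrite starP [RHS]starP !starX bS starK; apply: CH.
  have gbn : g ^+ n * b ^+ n = b ^+ n * g ^+ n.
    by apply/commrX/commr_sym/commrX/commr_sym.
  by rewrite -!mulE gbn.
have e' : (b ^+ n) (y - C y) = (a ^+ n) (C y).
  apply/eqP; rewrite -subr_eq0; apply/eqP/bnI; rewrite e opB.
  by rewrite -!mulE -gsbn -(ggn) !mulE CG subrr.
by rewrite mulE addE -e' opB subrK.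
Qed.

(** [P] commutes with [C] since [C * P = r] is self-adjoint; hence it commutes with [X ^+ n], then
    with [X] by [positive_root_commute], and finally with [b]. *)
Lemma reducing_resolvent : P * b = b * P.
Proof.
have [C Cs EC] := resolvent_exists.
have Ccomm f : GRing.comm f b -> GRing.comm f C.
  move=> fb; apply: (mul_injop injE).
  rewrite mulrA -(comm_E fb) -mulrA EC (mulrA E) EC.
  exact: commrX.
have Cb : GRing.comm C b by apply/commr_sym/Ccomm.
have aC : GRing.comm a C by apply/Ccomm.
(* This geometric sum allows [b] to be divided out of [C = (1 - a^n) C - b^n C + b^n]. *)
pose A := \sum_(i < n) a ^+ i.
have bA : b * A = 1 - a ^+ n.
  by rewrite -[RHS]opprB (subrX1 a n) -mulNr opprB /a subKr.
have fA f : GRing.comm f b -> GRing.comm f A.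
  by move=> fb; apply: commr_sum => i _; apply/commrX/comm_a.
(* [C1] is b^-1 C, and [X] below is N*N C^2. *)
pose C1 := A * C - b ^+ n.-1 * C + b ^+ n.-1.
have C1comm f : GRing.comm f b -> GRing.comm f C1.
  move=> fb; have fC := Ccomm _ fb; have fb' := commrX n.-1 fb.
  by apply: commrD => //; apply: commrB; apply: commrM => //; exact: fA.
have C1b : GRing.comm C1 b by apply/commr_sym/C1comm.
have C1C : GRing.comm C1 C by apply/Ccomm.
have bC1 : b * C1 = C.
  have -> : b * C1 = (1 - a ^+ n) * C - b ^+ n * C + b ^+ n.
    by rewrite mulrDr mulrBr !mulrA bA -exprS prednK.
  rewrite -[X in _ + X]EC -mulrBl -mulrDl -[1 - _ - _]addrA -opprD subrK.
  exact: mul1r.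
have aS : star a = a by rewrite starB star1 bS.
have AS : star A = A.
  by rewrite star_sum; apply: eq_bigr => i _; rewrite starX aS.
have C1s : star C1 = C1.
  rewrite starD starB !starM !starX bS AS Cs (fA _ Cb).
  by rewrite (commrX n.-1 Cb).
have CP : C * P = r.
  by apply: (mul_injop injE); rewrite mulrA EC resolvent_compression.
have PC : P * C = r by rewrite -Ps -Cs -starM CP rs.
have PCcomm : GRing.comm P C by rewrite /GRing.comm CP PC.
(* [L] is [b^-1 C^2], which equals [X + C^2]; so [P] will commute with both [L] and [b * L], and the
   injective [L] can be cancelled. *)
pose L := C * C1.
pose X := star (g * C1) * (g * C1).
have XE : X = a * L.
  rewrite /X starM C1s -mulrA (mulrA (star g)) gg -mulrA (mulrA C1) C1b bC1.
  by rewrite mulrA -aC -mulrA.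
have bL : b * L = C * C by rewrite mulrA -Cb -mulrA bC1.
have XL : X + C * C = L by rewrite XE -bL -mulrDl /a subrK mul1r.
have bX : b * X = a * (C * C) by rewrite XE mulrA -ab -mulrA bL.
have aCn : a ^+ n * C = b ^+ n * (1 - C).
  by rewrite mulrBr mulr1 -[in X in X - _]EC mulrDl addrK.
(* Formally [(N*N)^n C = 1 - C], so that [X ^+ n] is a polynomial in [C]. *)
have Xn : X ^+ n = (1 - C) * (C ^+ n.-1 * C ^+ n).
  apply: (mul_injop bnI); rewrite -exprMn_comm; last first.
    rewrite XE; apply: commrM; first exact: commr_sym.
    by apply: commrM; exact: commr_sym.
  rewrite bX exprMn_comm; last by apply: commrM.
  have Cn : C * C ^+ n.-1 = C ^+ n by rewrite -exprS prednK.
  by rewrite exprMn_comm// (mulrA (b ^+ n)) -aCn -mulrA (mulrA C) Cn.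
have PX : X * P = P * X.
  apply: (@positive_root_commute _ _ X P (g * C1) n) => //.
  apply/commr_sym; rewrite Xn; apply: commrM; last by apply: commrM; exact: commrX.
  by apply: commrB => //; exact: commr1.
have PL : GRing.comm P L.
  by rewrite -XL; apply: commrD => //; exact: commrM.
have Ls : star L = L by rewrite starM Cs C1s C1C.
have LI : injop L.
  have CI : injop C by move=> x Cx; apply: bnI; rewrite -EC mulE Cx op0.
  by apply: injopM => // x C1x; apply: CI; rewrite -bC1 mulE C1x op0.
have : (b * P - P * b) * L = 0.
  have bPL : b * P * L = C * C * P by rewrite -mulrA PL mulrA bL.
  have PbL : P * b * L = C * C * P by rewrite -mulrA bL (commrM PCcomm PCcomm).
  by rewrite mulrBl bPL PbL subrr.
move=> /(congr1 (@star _ _)); rewrite (starM _ L) Ls starB (starM b) (starM P) star0 Ps bS.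
by move/(mul_injop0 LI)/eqP; rewrite subr_eq0 => /eqP.
Qed.

(** [Z] measures the failure of the range of [P] to be invariant under [star g]. As [P] commutes
    with [g ^+ n] and with [star g * g], one finds [g ^+ n * Z = 0]; normality reduces this to
    [g * Z = 0], which forces [Z = 0]. *)
Lemma reducing_normal : P * b = b * P -> P * g * P = g * P -> P * g = g * P.
Proof.
move=> Pb PgP.
have Pgn k : P * g ^+ k * P = g ^+ k * P.
  elim: k => [|k IH]; first by rewrite !expr0 mulr1 mul1r.
  by rewrite exprS -!mulrA -{1}IH !mulrA PgP -!mulrA [P * _]mulrA IH.
have Pgn' : P * g ^+ n * P = P * g ^+ n.
  (* The range of [star s] lies in that of [P], so [star g ^+ n] maps the range of [r] there; the
     adjoint identity, freed of [r] by [rI], is the claim. *)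
  have e : P * (star g ^+ n * r) = star g ^+ n * r.
    have Pbn : P * b ^+ n = b ^+ n * P by apply: commrX.
    have Pss : P * star s = star s by rewrite -Ps -starM sP.
    by rewrite -bs' mulrA Pbn -mulrA Pss.
  have : r * (g ^+ n * P - g ^+ n) = 0.
    have /(congr1 (@star _ _)) := e.
    rewrite !starM starX starK rs Ps => e'.
    by rewrite mulrBr mulrA e' subrr.
  by move/rI/eqP; rewrite mulrBr subr_eq0 mulrA => /eqP.
have gnP : P * g ^+ n = g ^+ n * P by rewrite -Pgn' Pgn.
pose Z := (1 - P) * star g * P.
have Pa : P * a = a * P by apply: comm_a.
have gnZ : g ^+ n * Z = 0.
  have -> : g ^+ n * Z = (1 - P) * (star g * g ^+ n * P).
    have gsgn : star g * g ^+ n = g ^+ n * star g by apply: commrX.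
    have Qgn : (1 - P) * g ^+ n = g ^+ n * (1 - P).
      by rewrite mulrBl mulrBr gnP mul1r mulr1.
    by rewrite gsgn !mulrA Qgn.
  have Pba : P * (b * a) = b * a * P by exact: commrM Pb Pa.
  have -> : star g * g ^+ n * P = P * (b * a * (g ^+ n.-1 * P)).
    rewrite -{1}(prednK n0) exprS (mulrA (star g)) gg -mulrA -{1}Pgn.
    by rewrite -[P * _ * P]mulrA (mulrA (b * a)) -Pba -mulrA.
  by rewrite (mulrA (1 - P)) mulrBl mul1r PP subrr mul0r.
have gZ : g * Z = 0.
  by apply: (@normal_exp_eq0 _ _ _ _ n.-1) => //; rewrite prednK.
have Z0 : Z = 0.
  apply: star_mul_eq0; rewrite {1}/Z !starM starK starB star1 Ps -!mulrA.
  suff -> : (1 - P) * Z = Z by rewrite gZ mulr0.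
  have QQ : (1 - P) * (1 - P) = 1 - P.
    by rewrite mulrBr mulr1 mulrBl mul1r PP subrr subr0.
  by rewrite /Z !mulrA QQ.
have : star g * P = P * star g * P.
  by move/eqP: Z0; rewrite /Z !mulrBl mul1r subr_eq0 => /eqP.
move=> /(congr1 (@star _ _)); rewrite !starM starK Ps => ->.
by rewrite mulrA PgP.
Qed.

(** [E * r = b ^+ n * P] determines [r], as [E] is injective. *)
Lemma resolvent_commute f : f * b = b * f -> P * f = f * P -> f * r = r * f.
Proof.
move=> fb Pf; apply: (mul_injop injE).
have fE : f * E = E * f by exact: comm_E.
have fbn : f * b ^+ n = b ^+ n * f by exact: commrX.
rewrite mulrA -fE -mulrA resolvent_compression (mulrA E) resolvent_compression.
by rewrite mulrA fbn -!mulrA Pf.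
Qed.

End Reducing.

(** * From the extension to the operator *)

Section Extension.
Variables (R : realType) (H K : hilbertType R) (j : {linear H -> K}).
Hypothesis j_ip : forall x y, ip (j x) (j y) = ip x y.

(** Projecting [(0, y)] on the graph of [j] minimizes [n2 p + n2 (y - j p)]; at the minimum
    [2 p = j* y], hence the witness [p1 + p1]. *)
Lemma isometry_adjoint : exists jst : K -> H, forall y x, ip (jst y) x = ip y (j x).
Proof.
have n2j x : n2 (j x) = n2 x by apply: complexI; rewrite -!ipxx j_ip.
suff /choice[jst Hjst] : forall y, exists z, forall x, ip z x = ip y (j x).
  by exists jst.
move=> y.
have [||p1 [p2 [-> Hp]]] := projection 0 y (G := fun x z => z = j x).
- split=> [|c x z x' z' -> ->]; first by rewrite linear0.
  by rewrite linearP.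
- move=> u v x z uv ux vz; apply: tends_uniq vz _ => e /ux[N HN].
  by exists N => k /HN; rewrite uv -linearB n2j.
exists (p1 + p1) => x; have /eqP := Hp x _ erefl.
rewrite sub0r ipNl !(ipDl, ipNl) j_ip addrC addr_eq0 opprK subr_eq => /eqP ->.
by [].
Qed.

Variable jst : K -> H.
Hypothesis jstP : forall y x, ip (jst y) x = ip y (j x).

Lemma n2_isometry x : n2 (j x) = n2 x.
Proof. by apply: complexI; rewrite -!ipxx j_ip. Qed.
Lemma jstK x : jst (j x) = x.
Proof. by apply: ip_inj => z; rewrite jstP j_ip. Qed.
Lemma jst_ipr y x : ip x (jst y) = ip (j x) y.
Proof. by rewrite ipC jstP -ipC. Qed.
Lemma n2_jst y : n2 (jst y) <= n2 y.
Proof.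
have e : rp y (j (jst y)) = n2 (jst y) by rewrite /rp -jstP ipxx.
by have := n2_ge0 (y - j (jst y)); rewrite n2B e n2_isometry; lra.
Qed.

Lemma bounded_lift (f : op H) : bounded_fun (j \o f \o jst).
Proof.
have [c c0 cP] := bounded_funP (op_bounded f).
exists c => y /=; rewrite n2_isometry; apply: le_trans (cP _) _.
by rewrite ler_pM2l// n2_jst.
Qed.

Lemma lift_adj (f : op H) x y :
  ip ((j \o f \o jst) x) y = ip x ((j \o star f \o jst) y).
Proof. by rewrite /= -jst_ipr starP jstP. Qed.

(** In particular [lift 1] is the orthogonal projection of [K] onto the image of [H]. *)
Definition lift (f : op H) : op K :=
  Op (lift_adj f) (bounded_lift f) (bounded_lift (star f)).

Lemma bounded_compress (F : op K) : bounded_fun (jst \o F \o j).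
Proof.
have [c c0 cP] := bounded_funP (op_bounded F).
exists c => y /=; apply: le_trans (n2_jst _) _.
by rewrite -(n2_isometry y).
Qed.

Lemma compress_adj (F : op K) x y :
  ip ((jst \o F \o j) x) y = ip x ((jst \o star F \o j) y).
Proof. by rewrite /= jstP starP jst_ipr. Qed.

Definition compress (F : op K) : op H :=
  Op (compress_adj F) (bounded_compress F) (bounded_compress (star F)).

Lemma liftE f y : lift f y = j (f (jst y)). Proof. by []. Qed.
Lemma compressE F x : compress F x = jst (F (j x)). Proof. by []. Qed.
Lemma lift_star f : star (lift f) = lift (star f). Proof. exact: op_ext. Qed.
Lemma compress_star F : star (compress F) = compress (star F).
Proof. exact: op_ext. Qed.
Lemma liftM f g : lift (f * g) = lift f * lift g.
Proof. by apply: op_ext => y; rewrite mulE !liftE mulE jstK. Qed.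
Lemma liftB f g : lift (f - g) = lift f - lift g.
Proof. by apply: op_ext => y; rewrite addE oppE !liftE addE oppE linearB. Qed.
Lemma lift1j x : lift 1 (j x) = j x.
Proof. by rewrite liftE jstK. Qed.
Lemma jstD y z : jst (y + z) = jst y + jst z.
Proof. by apply: ip_inj => x; rewrite ipDl !jstP ipDl. Qed.
Lemma jst0 : jst 0 = 0.
Proof. by apply: ip_inj => x; rewrite jstP !ip0l. Qed.
Lemma jst_lift1 y : jst (lift 1 y) = jst y.
Proof. by rewrite liftE jstK. Qed.
Lemma compressD F G : compress (F + G) = compress F + compress G.
Proof. by apply: op_ext => x; rewrite addE !compressE addE jstD. Qed.
Lemma compress1 : compress 1 = 1.
Proof. by apply: op_ext => x; rewrite compressE jstK. Qed.
Lemma compressM F G : lift 1 * F = F * lift 1 ->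
  compress (F * G) = compress F * compress G.
Proof.
move=> PF; apply: op_ext => x; rewrite mulE !compressE -[j (jst _)]/(lift 1 _).
by rewrite -(mulE F) -PF !mulE jst_lift1.
Qed.
Lemma compressN F : compress (- F) = - compress F.
Proof.
by apply/eqP; rewrite -addr_eq0 -compressD addNr; apply/eqP/op_ext => x; exact: jst0.
Qed.

(** Compression is multiplicative when the left factor commutes with the projection, so the
    identities of a normal pair descend to a reducing subspace. *)
Lemma compress_normal_pair b g : lift 1 * b = b * lift 1 -> lift 1 * g = g * lift 1 ->
  normal_pair b g -> normal_pair (compress b) (compress g).
Proof.
move=> Pb Pg [bs bi gb gg' g'g].
have Ps : star (lift 1) = lift 1 by rewrite lift_star star1.
have Pgs : lift 1 * star g = star g * lift 1 by rewrite -{1}Ps -starM -Pg starM Ps.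
split.
- by rewrite compress_star bs.
- move=> x e; rewrite -(jstK x) -[RHS]jst0; congr jst; apply: bi.
  rewrite -{1}(lift1j x) -mulE -Pb mulE liftE -compressE e op0.
  by rewrite linear0.
- by rewrite -!compressM// gb.
- by rewrite compress_star -compressM// gg' compressM// compressD compressN compress1.
- by rewrite compress_star -compressM// g'g compressM// compressD compressN compress1.
Qed.

(** [N^n] extends [T^n], in quotient form: each step moves [g] past the accumulated [b ^+ n]. *)
Lemma op_exp_extends (T : partial_op H) (b g : op K) n : g * b = b * g ->
  (forall x y, graph T x y -> g (j x) = b (j y)) ->
  forall x y, graph (op_exp T n) x y -> (g ^+ n) (j x) = (b ^+ n) (j y).
Proof.
move=> gb TG; elim: n => [|n IH] x y [dx <-]//.
case: dx => dx dTx.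
rewrite exprS mulE (IH x (op_exp T n x)) // -mulE.
have -> : g * b ^+ n = b ^+ n * g by exact: commrX.
rewrite mulE (TG _ (T (op_exp T n x))) //.
by rewrite exprSr.
Qed.

Lemma dom_op_exp (T : partial_op H) n x : (0 < n)%N -> dom (op_exp T n) x -> dom T x.
Proof. by case: n => // n _; elim: n => [[_]//|n IH [/IH]]. Qed.

(** * Adjoints of the powers, and the part of the extension in the subspace *)

Section Powers.
Variables (b g : op K) (rH gH : op H) (T : partial_op H) (n : nat).
Hypotheses (n0 : (0 < n)%N) (bg : normal_pair b g) (rg : normal_pair rH gH).
Hypotheses (Td : dense (dom T)) (TG : forall x y, graph T x y -> g (j x) = b (j y)).
Hypothesis SG : represents (op_exp T n) rH gH.

Let bs : star b = b. Proof. by case: bg. Qed.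
Let bi : injop b. Proof. by case: bg. Qed.
Let gb : g * b = b * g. Proof. by case: bg. Qed.
Let gn : star g * g = g * star g. Proof. by case: bg => _ _ _ -> ->. Qed.
Let rS : star rH = rH. Proof. by case: rg. Qed.
Let rI : injop rH. Proof. by case: rg. Qed.
Let gr : gH * rH = rH * gH. Proof. by case: rg. Qed.
Let gHn : star gH * gH = gH * star gH. Proof. by case: rg => _ _ _ -> ->. Qed.
Let gHr : star gH * gH = rH * (1 - rH). Proof. by case: rg. Qed.
Let grs : star gH * rH = rH * star gH.
Proof. by rewrite -{1}rS -starM -gr starM rS. Qed.
Let gbn : g ^+ n * b ^+ n = b ^+ n * g ^+ n.
Proof. by apply/commrX/commr_sym/commrX/commr_sym. Qed.
Let SGr u : graph (op_exp T n) (rH u) (gH u).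
Proof. by apply/SG; rewrite -!mulE gr. Qed.
Let Sr u : (g ^+ n) (j (rH u)) = (b ^+ n) (j (gH u)).
Proof. exact: (op_exp_extends gb TG). Qed.

(* N*^n extends S*: the projection of N*^n (rH u) to H is S* (rH u), and both
   have the same norm. *)
Lemma power_adjoint u : (b ^+ n) (j (star gH u)) = (star g ^+ n) (j (rH u)).
Proof.
have bns : star (b ^+ n) = b ^+ n by rewrite starX bs.
have gnn : star (g ^+ n) * g ^+ n = g ^+ n * star (g ^+ n).
  by rewrite starX; apply/commrX/commr_sym/commrX/commr_sym.
(* [z] is the value of the adjoint of [N^n] at [j (rH u)], and is no longer than [gH u]. *)
have [z ze zn] := quotient_normal bns (injopX (n:=n) bi) gbn gnn (Sr u).
have jz : jst z = star gH u.
  apply/eqP; rewrite -subr_eq0; apply/eqP/rI/ip_eq0 => w; rewrite starP rS.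
  have := quotient_adjoint bns (injopX (n:=n) bi) gbn (Sr w) ze.
  rewrite j_ip -jst_ipr starP -mulE grs mulE -[in LHS]rS -starP => e.
  by rewrite ipC ipDr ipNr -e subrr conjc0.
suff -> : j (star gH u) = z by rewrite -ze starX.
(* By normality of [T^n], [gH u] is as long as [star gH u = jst z]; so [z] is no longer than its
   projection and equals it. *)
apply/esym/eqP; rewrite -subr_eq0; apply/eqP/n2_eq0/le_anti; rewrite n2_ge0 andbT.
have nn : n2 (gH u) = n2 (star gH u) by apply: n2_star; rewrite starK.
have e : rp z (j (star gH u)) = n2 (star gH u) by rewrite /rp -jstP jz ipxx.
by move: zn; rewrite n2B e !n2_isometry nn; lra.
Qed.

(** [T] is the part of [N] in [H], represented by the compressions of [b] and [g]. That this part is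
    no larger than [T] comes from the range of [rH], contained in the domain of [T^n] and so in that
    of [T]. *)
Lemma representable : closed_op T -> linear_op T ->
  exists b' g', normal_pair b' g' /\ represents T b' g'.
Proof.
move=> Tcl Tlin.
pose P := lift 1; pose r := lift rH; pose s := lift gH.
have Ps : star P = P by rewrite lift_star star1.
have PP : P * P = P by rewrite -liftM mulr1.
have rs : star r = r by rewrite lift_star rS.
have Pr : P * r = r by rewrite -liftM mul1r.
have sP : s * P = s by rewrite -liftM mulr1.
have jI x : j x = 0 -> x = 0 by move=> e; rewrite -(jstK x) e jst0.
have rPI f : r * f = 0 -> P * f = 0.
  move=> e; apply: op_ext => y; have := congr1 (fun h : op K => h y) e.
  by rewrite !mulE !liftE => /jI/rI ->; rewrite op0 linear0.
have ss : star s * s = r - r * r.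
  by rewrite lift_star -!liftM -liftB gHr mulrBr mulr1.
have rsC : r * s = s * r by rewrite -!liftM gr.
have R1 : b ^+ n * s = g ^+ n * r.
  by apply: op_ext => y; rewrite !mulE !liftE Sr.
have R2 : b ^+ n * star s = star g ^+ n * r.
  by apply: op_ext => y; rewrite lift_star !mulE !liftE power_adjoint.
have Pb : P * b = b * P by exact: reducing_resolvent ss rsC R1 R2.
have PgP : P * g * P = g * P.
  (* [star g] preserves the complement of [H]: against [j x] with [x] in the dense domain of [T],
     the pairing involves [g (j x) = b (j (T x))], and [b] preserves [H]. *)
  have F0 : P * (star g * (1 - P)) = 0.
    apply: op_ext => y; rewrite mulE liftE oneE.
    suff -> : jst ((star g * (1 - P)) y) = 0 by rewrite linear0.
    apply: (dense_ip_eq0 Td) => x dx.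
    rewrite jst_ipr mulE -starP (TG (conj dx erefl)) -(lift1j (T x)) -/P.
    rewrite -mulE -Pb mulE starP Ps -mulE mulrBr mulr1 PP subrr.
    exact: ip0r.
  have /(congr1 (@star _ _)) := F0.
  rewrite !starM starK starB star1 Ps star0 mulrBl mul1r mulrBl => /eqP.
  by rewrite subr_eq0 => /eqP.
have Pg : P * g = g * P.
  exact: reducing_normal rPI sP R2 Pb PgP.
have br : b * r = r * b by exact: resolvent_commute ss rsC R1 R2 _ _ Pb.
have gr' : g * r = r * g by exact: resolvent_commute ss rsC R1 R2 _ gb Pg.
have comp_r F : F * r = r * F -> compress F * rH = rH * compress F.
  move=> Fr; apply: op_ext => x; rewrite !mulE !compressE.
  have -> : j (rH x) = r (j x) by rewrite liftE jstK.
  by rewrite -mulE Fr mulE liftE jstK.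
have np := compress_normal_pair Pb Pg bg.
exists (compress b), (compress g); split=> // x y; split=> [Txy|gxy].
  by rewrite !compressE (TG Txy).
(* The residual [(d, e)] is brought into the graph of [T] by [rH], and orthogonality becomes
   [ip d (rH d) + ip e (rH e) = 0], a sum of nonnegative terms. *)
have [p [q [Tpq Hpq]]] := projection x y (linear_op_rel Tlin) (closed_op_rel Tcl).
have gpq : compress g p = compress b q by rewrite !compressE (TG Tpq).
have [_ b'i _ _ _] := np.
set d := x - p; set e := y - q.
have gde : compress g d = compress b e by rewrite !opB gxy gpq.
have Trd : graph T (rH d) (rH e).
  have dr : dom T (rH d) by apply: (dom_op_exp n0); case: (SGr d).
  split=> //; apply/eqP; rewrite -subr_eq0; apply/eqP/b'i; rewrite opB.
  have <- : compress g (rH d) = compress b (T (rH d)).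
    by rewrite !compressE (TG (conj dr erefl)).
  by rewrite -!mulE (comp_r _ gr') (comp_r _ br) !mulE gde subrr.
(* This uses [rH = rH * rH + star gH * gH]. *)
have pos v : ip v (rH v) = (n2 (rH v) + n2 (gH v))%:C.
  rewrite rmorphD /= !n2E -ipDr -addE rS gHr mulrBr mulr1 addrC subrK.
  by [].
have := Hpq _ _ Trd; rewrite -/d -/e !pos -rmorphD => -[] h.
have rd : n2 (rH d) = 0 /\ n2 (rH e) = 0.
  have := n2_ge0 (rH d); have := n2_ge0 (rH e).
  have := n2_ge0 (gH d); have := n2_ge0 (gH e).
  by move=> *; split; lra.
case: rd => /n2_eq0/rI/eqP + /n2_eq0/rI/eqP.
by rewrite !subr_eq0 => /eqP -> /eqP ->.
Qed.
End Powers.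
End Extension.

Theorem corollary2p11 (R : realType) (H : hilbertType R) (T : partial_op H)
    (n : nat) (T_closed : closed_op T) (T_subnormal : subnormal_op T)
    (n_ge2 : (2 <= n)%N) (Tn_normal : normal_op (op_exp T n)) :
  normal_op T.
Proof.
have [Tlin Td [K [j [N [j_ip _ Nn NT]]]]] := T_subnormal.
have n0 : (0 < n)%N by exact: ltnW.
have [b [g [bg NG]]] := normal_op_represents Nn.
have [rH [gH [rg SG]]] := normal_op_represents Tn_normal.
have [jst jstP] := isometry_adjoint j_ip.
have TG x y : graph T x y -> g (j x) = b (j y).
  by move=> [/NT[dx Nx] <-]; apply/NG; split.
have [b' [g' [bg' TG']]] := representable j_ip jstP n0 bg rg Td TG SG T_closed Tlin.
exact: represents_normal_op bg' TG'.
Qed.
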